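(* Fix a positive integer $t$ and consider the class of finite graphs that do not contain the complete bipartite graph $K_{t,t}$ as a (not necessarily induced) subgraph. On this class: (i) tree-width and component twin-width are functionally equivalent; (ii) path-width and total twin-width are functionally equivalent. That is, there is a function $f_t$ such that for every $K_{t,t}$-subgraph-free graph $G$: $\mathrm{tw}(G)\le f_t(\mathrm{ltww}(G))$, $\mathrm{ltww}(G)\le f_t(\mathrm{tw}(G))$, $\mathrm{pw}(G)\le f_t(\mathrm{ttww}(G))$ and $\mathrm{ttww}(G)\le f_t(\mathrm{pw}(G))$.
   Context: $\mathrm{tw}$ and $\mathrm{pw}$ denote tree-width and path-width. A partition sequence of an $n$-vertex graph $G$ is a sequence $\mathcal P_n,\dots,\mathcal P_1$ of partitions of $V(G)$ where $\mathcal P_n$ consists of singletons, $\mathcal P_1=\{V(G)\}$, and each $\mathcal P_i$ is obtained from $\mathcal P_{i+1}$ by merging two parts. Two disjoint vertex sets $X,Y$ are homogeneous if all or none of the pairs $x\in X$, $y\in Y$ are edges. For a partition $\mathcal P$, its red edges are the pairs of distinct non-homogeneous parts, plus one red loop at each part with at least two vertices; the red graph has vertex set $\mathcal P$ and these red edges. Component twin-width $\mathrm{ltww}(G)$ is the minimum over partition sequences of $\max_i$ of the largest number of parts in a connected component of the red graph of $\mathcal P_i$. Total twin-width $\mathrm{ttww}(G)$ is the minimum over partition sequences of $\max_i$ of the total number of red edges (loops included) of $\mathcal P_i$. *)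

(* Defs.v *)
From mathcomp Require Import all_boot.
From mathcomp Require Import boolp zify.

Set Implicit Arguments.
Unset Strict Implicit.
Unset Printing Implicit Defensive.

Record sgraph := SGraph {
  vertex :> finType;
  adj : rel vertex;
  adj_sym : symmetric adj;
  adj_irr : irreflexive adj }.

Definition subgraph (H G : sgraph) : Prop :=
  exists2 h : H -> G, injective h & forall x y : H, adj x y -> adj (h x) (h y).

Definition bip_adj (s t : nat) : rel ('I_s + 'I_t) :=
  fun x y => match x, y with
             | inl _, inr _ | inr _, inl _ => true
             | _, _ => false
             end.

Lemma bip_adj_sym s t : symmetric (@bip_adj s t).
Proof. by case=> [?|?] [?|?]. Qed.

Lemma bip_adj_irr s t : irreflexive (@bip_adj s t).
Proof. by case. Qed.

Definition complete_bipartite (s t : nat) : sgraph :=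
  SGraph (@bip_adj_sym s t) (@bip_adj_irr s t).

(* The least element of P; the value 0 for an empty P is a dummy, never
   reached by the four parameters below (exists_path_decomposition,
   is_tree_path_graph0, exists_partition_sequence). *)
Definition nat_min (P : nat -> Prop) : nat :=
  if pselect (exists k, `[< P k >]) is left exP then ex_minn exP else 0.

Lemma nat_minP (P : nat -> Prop) : (exists k, P k) ->
  P (nat_min P) /\ forall k, P k -> nat_min P <= k.
Proof.
move=> [k0 Pk0]; rewrite /nat_min; case: pselect => [exP|]; last first.
  by case; exists k0; apply/asboolP.
case: ex_minnP => m /asboolP Pm mmin; split=> // k Pk.
by apply: mmin; apply/asboolP.
Qed.

Definition is_tree (H : sgraph) : Prop :=
  [/\ 0 < #|H|,
      forall i j : H, connect (@adj H) i j
    & forall c : seq H, 2 < size c -> ~ ucycle (@adj H) c].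

Definition path_adj (n : nat) : rel 'I_n.+1 :=
  fun i j => (i.+1 == j :> nat) || (j.+1 == i :> nat).

Lemma path_adj_sym n : symmetric (@path_adj n).
Proof. by move=> i j; rewrite /path_adj orbC. Qed.

Lemma path_adj_irr n : irreflexive (@path_adj n).
Proof. by move=> i; rewrite /path_adj orbb gtn_eqF. Qed.

Definition path_graph (n : nat) : sgraph :=
  SGraph (@path_adj_sym n) (@path_adj_irr n).

Definition decomposition (G H : sgraph) (B : H -> {set G}) : Prop :=
  [/\ forall x : G, exists i, x \in B i,
      forall x y : G, adj x y -> exists i, (x \in B i) && (y \in B i)
    & forall (x : G) (i j : H), x \in B i -> x \in B j ->
        connect (fun k l => [&& adj k l, x \in B k & x \in B l]) i j].

(* Truncated predecessor: the graph without vertices gets width 0. *)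
Definition decomposition_width (G H : sgraph) (B : H -> {set G}) : nat :=
  (\max_(i : H) #|B i|).-1.

Definition treewidth (G : sgraph) : nat :=
  nat_min (fun k => exists (H : sgraph) (B : H -> {set G}),
    [/\ is_tree H, decomposition B & decomposition_width B = k]).

Definition pathwidth (G : sgraph) : nat :=
  nat_min (fun k => exists (n : nat) (B : path_graph n -> {set G}),
    decomposition B /\ decomposition_width B = k).

Definition merges (T : finType) (P Q : {set {set T}}) : Prop :=
  exists X Y, [/\ X \in P, Y \in P, X != Y
                & Q = (X :|: Y) |: (P :\: [set X; Y])].

(* Only the values of P at 1, ..., #|G| matter. *)
Definition partition_sequence (G : sgraph) (P : nat -> {set {set G}}) : Prop :=
  [/\ forall i, 0 < i <= #|G| -> partition (P i) [set: G],
      P #|G| = [set [set x] | x : G],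
      P 1 = [set [set: G]]
    & forall i, 0 < i < #|G| -> merges (P i.+1) (P i)].

Definition homogeneous (G : sgraph) (X Y : {set G}) : bool :=
  [forall x in X, forall y in Y, adj x y] ||
  [forall x in X, forall y in Y, ~~ adj x y].

Definition red (G : sgraph) (X Y : {set G}) : bool :=
  if X == Y then 1 < #|X| else ~~ homogeneous X Y.

Definition red_adj (G : sgraph) (P : {set {set G}}) : rel {set G} :=
  fun X Y => [&& X \in P, Y \in P & red X Y].

(* Unordered pairs of parts; the loop at X is [set X; X] = [set X]. *)
Definition red_edges (G : sgraph) (P : {set {set G}}) : {set {set {set G}}} :=
  [set [set X; Y] | X in P, Y in P & red X Y].

Definition max_red_component (G : sgraph) (P : {set {set G}}) : nat :=
  \max_(X in P) #|[set Y in P | connect (red_adj P) X Y]|.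

Definition component_twinwidth (G : sgraph) : nat :=
  nat_min (fun k => exists P : nat -> {set {set G}}, partition_sequence P /\
    \max_(1 <= i < #|G|.+1) max_red_component (P i) = k).

Definition total_twinwidth (G : sgraph) : nat :=
  nat_min (fun k => exists P : nat -> {set {set G}}, partition_sequence P /\
    \max_(1 <= i < #|G|.+1) #|red_edges (P i)| = k).

Lemma merges_partition (T : finType) (P Q : {set {set T}}) :
  partition P [set: T] -> merges P Q ->
  partition Q [set: T] /\ #|Q|.+1 = #|P|.
Proof.
case/and3P=> /eqP covP tiP P0 [X [Y [XP YP neXY ->]]].
have dis A B : A \in P -> B \in P -> A != B -> [disjoint A & B] by exact: (trivIsetP tiP).
have X0 : X != set0 by apply: contraNneq P0 => <-.
have XYP : X :|: Y \notin P :\: [set X; Y].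
  rewrite !inE; apply/negP => /andP[/norP[h1 h2] h3].
  have := dis _ _ h3 XP h1; rewrite -setI_eq0 setUK => /eqP E.
  by rewrite E eqxx in X0.
split.
  apply/and3P; split.
  - apply/eqP/setP=> x; rewrite inE; apply/bigcupP.
    have : x \in cover P by rewrite covP.
    case/bigcupP=> A AP xA.
    case: (boolP (A \in [set X; Y])) => hA.
      exists (X :|: Y); first by rewrite !inE eqxx.
      by case/set2P: hA xA => -> h; rewrite inE h ?orbT.
    by exists A => //; rewrite !inE AP andbT -in_set2 hA orbT.
  - have D A : A \in P :\: [set X; Y] -> [disjoint X :|: Y & A].
      rewrite !inE negb_or => /andP[/andP[h1 h2] h3].
      rewrite disjoints_subset subUset -!disjoints_subset.
      by rewrite !dis // eq_sym.
    apply/trivIsetP=> A B /setU1P[->|hA] /setU1P[->|hB]; rewrite ?eqxx //.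
    + by move=> _; apply: D.
    + by move=> _; rewrite disjoint_sym; apply: D.
    + by apply: dis; [move: hA|move: hB]; rewrite inE => /andP[].
  - rewrite !inE (negPf P0) andbF orbF eq_sym setU_eq0 (negPf X0) //.
rewrite cardsU1 XYP cardsD.
have -> : P :&: [set X; Y] = [set X; Y].
  by apply/setIidPr/subsetP=> A /set2P[]->.
have : #|[set X; Y]| <= #|P| by apply/subset_leq_card/subsetP=> A /set2P[]->.
rewrite cards2 neXY /=; lia.
Qed.

Lemma exists_partition_sequence (G : sgraph) :
  exists P : nat -> {set {set G}}, partition_sequence P.
Proof.
case: (posnP #|G|) => [G0|Gpos].
  exists (fun i => if i == 1 then [set setT] else [set [set x] | x : G]).
  by split=> [i||//|i]; rewrite ?G0 //; lia.
pose S := [set [set x] | x : G].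
have cS : #|S| = #|G| by rewrite card_imset //; apply: set1_inj.
have pS : partition S setT.
  apply/and3P; split.
  - apply/eqP/setP=> x; rewrite inE; apply/bigcupP; exists [set x]; rewrite ?set11 //.
    exact: imset_f.
  - apply/trivIsetP=> _ _ /imsetP[x _ ->] /imsetP[y _ ->] h.
    by rewrite disjoints1 inE; apply: contraNneq h => ->.
  - by apply/imsetP=> -[x _ /setP /(_ x)]; rewrite !inE eqxx.
have stepP (Q : {set {set G}}) : exists Q', 1 < #|Q| -> merges Q Q'.
  case: (ltnP 1 #|Q|) => [/card_gt1P[X [Y [XQ YQ ne]]]|_]; last by exists Q.
  by exists ((X :|: Y) |: (Q :\: [set X; Y])) => _; exists X, Y.
have [step sP] := choice stepP.
pose P i := iter (#|G| - i) step S.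
have inv k : k < #|G| -> partition (iter k step S) setT /\ #|iter k step S| + k = #|G|.
  elim: k => [|k IH] hk /=; first by rewrite addn0.
  have [p c] := IH (ltnW hk).
  have [] := @merges_partition _ (iter k step S) (step (iter k step S)) p.
    by apply: sP; lia.
  by move=> p' c'; split=> //; rewrite addnS -addSn c' c.
exists P; split.
- by move=> i hi; apply: (inv _ _).1; lia.
- by rewrite /P subnn.
- have [|] := inv (#|G| - 1); first lia.
  rewrite -/(P 1) => p c; have : #|P 1| == 1 by lia.
  move/cards1P=> [A hA]; rewrite hA in p *.
  by case/and3P: p => /eqP; rewrite /cover big_set1 => ->.
- move=> i hi; have e : #|G| - i = (#|G| - i.+1).+1 by lia.
  rewrite {2}/P e iterS -/(P i.+1); apply: sP.
  have [|_] := inv (#|G| - i.+1); first lia.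
  rewrite -/(P i.+1); move: (#|P i.+1|) => a; lia.
Qed.

Lemma exists_path_decomposition (G : sgraph) :
  exists (n : nat) (B : path_graph n -> {set G}), decomposition B.
Proof.
exists 0, (fun=> setT); split=> [x|x y _|x i j _ _]; try by exists ord0; rewrite !inE.
by rewrite (ord1 i) (ord1 j) connect0.
Qed.

Lemma is_tree_path_graph0 : is_tree (path_graph 0).
Proof.
split=> [|i j|c hc /andP[_ u]]; first by rewrite card_ord.
  by rewrite (ord1 i) (ord1 j) connect0.
by have := uniq_leq_size u (s2 := enum 'I_1); rewrite -cardE card_ord leqNgt (leq_trans _ hc) // => H; have := H (fun x _ => mem_enum _ _).
Qed.

(* Main.v *)
Require Import Defs.
From mathcomp Require Import all_boot.
From mathcomp Require Import boolp zify.

(** To bound total twin-width by path-width, order the vertices by their last bag and swallow them one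
    by one into a single part: red edges only join this part to the bag of the
    vertex swallowed last.
    For component twin-width, a rooted tree-decomposition gives a perfect elimination
    order of a chordal supergraph; merge each vertex, in this order, into the
    block of its elimination-tree parent. All vertices of a block but its root
    have their outside neighbours among the boundedly many later neighbours of
    the root, so splitting every block by outside neighbourhoods yields
    boundedly many parts per block and no red edge between blocks.

    Conversely, call a part big when it has more than t vertices. Two big parts
    joined by an edge are non-homogeneous, and at most t vertices are complete
    to a given big part. Hence, at each time, the vertices which are about to
    become big, lie in a small part of a red component, or have a neighbour in
    a big part of this component, form a bounded bag; red components only grow
    with time, so these bags form a tree-decomposition. For total twin-width
    there is one bag per time, and vertices that are still singletons without
    a neighbour in a big part are left out. *)

Set Implicit Arguments.
Unset Strict Implicit.
Unset Printing Implicit Defensive.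

(** * Widths as minima: upper bounds and optimal witnesses *)

Lemma nat_min_le (P : nat -> Prop) k : P k -> nat_min P <= k.
Proof. by move=> Pk; have [_] := nat_minP (ex_intro _ k Pk); apply. Qed.

Lemma nat_min_in (P : nat -> Prop) : (exists k, P k) -> P (nat_min P).
Proof. by case/nat_minP. Qed.

Lemma decomposition_width_le (G H : sgraph) (B : H -> {set G}) k :
  (forall i, #|B i| <= k.+1) -> decomposition_width B <= k.
Proof.
move=> hB; rewrite /decomposition_width.
have : \max_i #|B i| <= k.+1 by apply/bigmax_leqP=> i _; apply: hB.
by case: (\max_i _).
Qed.

Lemma leq_decomposition_width (G H : sgraph) (B : H -> {set G}) i :
  #|B i| <= (decomposition_width B).+1.
Proof.
apply: leq_trans (leqSpred _); exact: (@leq_bigmax _ (fun i => #|B i|)).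
Qed.

Lemma trivial_decomposition (G : sgraph) :
  decomposition (fun _ : path_graph 0 => [set: G]).
Proof.
split=> [x|x y _|x i j _ _]; try by exists ord0; rewrite !inE.
by rewrite (ord1 i) (ord1 j) connect0.
Qed.

Lemma treewidth_le (G H : sgraph) (B : H -> {set G}) k :
  is_tree H -> decomposition B -> (forall i, #|B i| <= k.+1) ->
  treewidth G <= k.
Proof.
move=> tH dB /decomposition_width_le; apply: leq_trans.
by apply: nat_min_le; exists H, B.
Qed.

Lemma treewidth_decomposition (G : sgraph) :
  exists (H : sgraph) (B : H -> {set G}),
    [/\ is_tree H, decomposition B & forall i, #|B i| <= (treewidth G).+1].
Proof.
have [|H [B [tH dB wB]]] := @nat_min_in (fun k => exists (H : sgraph)
    (B : H -> {set G}), [/\ is_tree H, decomposition B & decomposition_width B = k]).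
  exists (@decomposition_width G (path_graph 0) (fun=> setT)), (path_graph 0), (fun=> setT).
  by split=> //; [apply: is_tree_path_graph0 | apply: trivial_decomposition].
exists H, B; split=> // i.
by rewrite /treewidth -wB leq_decomposition_width.
Qed.

Lemma pathwidth_le (G : sgraph) n (B : path_graph n -> {set G}) k :
  decomposition B -> (forall i, #|B i| <= k.+1) -> pathwidth G <= k.
Proof.
move=> dB /decomposition_width_le; apply: leq_trans.
by apply: nat_min_le; exists n, B.
Qed.

Lemma pathwidth_decomposition (G : sgraph) :
  exists n (B : path_graph n -> {set G}),
    decomposition B /\ forall i, #|B i| <= (pathwidth G).+1.
Proof.
have [|n [B [dB wB]]] := @nat_min_in (fun k => exists n
    (B : path_graph n -> {set G}), decomposition B /\ decomposition_width B = k).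
  have [n [B dB]] := exists_path_decomposition G.
  by exists (decomposition_width B), n, B.
exists n, B; split=> // i.
by rewrite /pathwidth -wB leq_decomposition_width.
Qed.

(** Common form of both twin-widths: by conversion, [mu := @max_red_component G] gives
    [component_twinwidth] and [mu := fun P => #|red_edges P|] gives [total_twinwidth]. *)
Definition sequence_width (G : sgraph) (mu : {set {set G}} -> nat) : nat :=
  nat_min (fun k => exists P : nat -> {set {set G}}, partition_sequence P /\
    \max_(1 <= i < #|G|.+1) mu (P i) = k).

Lemma sequence_width_attained (G : sgraph) (mu : {set {set G}} -> nat) :
  exists P, partition_sequence P /\
    forall i, 0 < i <= #|G| -> mu (P i) <= sequence_width mu.
Proof.
have [|P [psP eP]] := @nat_min_in (fun k => exists P : nat -> {set {set G}},
    partition_sequence P /\ \max_(1 <= i < #|G|.+1) mu (P i) = k).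
  have [P psP] := exists_partition_sequence G.
  by exists (\max_(1 <= i < #|G|.+1) mu (P i)), P.
exists P; split=> // i hi; rewrite /sequence_width -eP.
by apply: (leq_bigmax_seq i) => //; rewrite mem_index_iota.
Qed.

(** * Refinement of partitions and chains of merges *)

Section Partitions.
Variable T : finType.
Implicit Types (P Q R : {set {set T}}) (x y : T).

Section PBlock.
Variables (P : {set {set T}}) (partP : partition P [set: T]).

Let cov x : x \in cover P.
Proof. by case/and3P: partP => /eqP->. Qed.

Let ti : trivIset P.
Proof. by case/and3P: partP. Qed.

Lemma mem_pb x : x \in pblock P x.
Proof. by rewrite mem_pblock. Qed.

Lemma pb_in x : pblock P x \in P.
Proof. exact: pblock_mem. Qed.

Lemma pb_eq X x : X \in P -> x \in X -> pblock P x = X.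
Proof. exact: def_pblock. Qed.

Lemma in_pb x y : (y \in pblock P x) = (pblock P y == pblock P x).
Proof.
apply/idP/eqP=> [yx|<-]; last exact: mem_pb.
by apply: pb_eq yx; apply: pb_in.
Qed.

Lemma part_neq0 X : X \in P -> exists x, x \in X.
Proof.
move=> XP; apply/set0Pn; apply: contraTneq XP => ->.
by case/and3P: partP.
Qed.

Lemma part_pb X : X \in P -> exists x, X = pblock P x.
Proof. by move=> XP; have [x xX] := part_neq0 XP; exists x; rewrite (pb_eq XP). Qed.

End PBlock.

Definition finer P Q := forall x, pblock P x \subset pblock Q x.

Lemma finer_trans P Q R : finer P Q -> finer Q R -> finer P R.
Proof. by move=> h1 h2 x; apply: subset_trans (h1 x) (h2 x). Qed.

Lemma finer_eq P Q x y : partition P [set: T] -> partition Q [set: T] ->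
  finer P Q -> pblock P x = pblock P y -> pblock Q x = pblock Q y.
Proof.
move=> pP pQ f e; apply/eqP; rewrite -in_pb //.
by apply: (subsetP (f y)); rewrite in_pb // e.
Qed.

Lemma pblock_inj P Q : partition P [set: T] -> partition Q [set: T] ->
  (forall x, pblock P x = pblock Q x) -> P = Q.
Proof.
move=> pP pQ h; apply/setP=> X; apply/idP/idP=> /part_pb[] // x ->.
  by rewrite h pb_in.
by rewrite -h pb_in.
Qed.

Lemma merges_pblock P Q : partition P [set: T] -> merges P Q ->
  exists X Y, forall x, pblock P x \subset pblock Q x /\
    (pblock P x \in [set X; Y] \/ pblock Q x = pblock P x).
Proof.
move=> pP m; have [pQ _] := merges_partition pP m.
case: m => X [Y [XP YP _ eQ]]; exists X, Y => x.
have [h|h] := boolP (pblock P x \in [set X; Y]).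
  have hs : pblock P x \subset X :|: Y.
    by case/set2P: h => ->; [apply: subsetUl | apply: subsetUr].
  have -> : pblock Q x = X :|: Y.
    by apply: pb_eq => //; [rewrite eQ !inE eqxx | apply: (subsetP hs); apply: mem_pb].
  by split=> //; left.
have -> : pblock Q x = pblock P x.
  by apply: pb_eq => //; [rewrite eQ in_setU1 in_setD h pb_in // orbT | apply: mem_pb].
by split=> //; right.
Qed.

Lemma partition_setT : 0 < #|T| -> partition [set [set: T]] [set: T].
Proof.
move=> T0; apply/and3P; split.
- by rewrite /cover big_set1.
- by apply/trivIsetP=> A B /set1P-> /set1P->; rewrite eqxx.
- by rewrite inE eq_sym -cards_eq0 cardsT -lt0n.
Qed.

(** An index-free partition sequence starting at any partition, so that steps can be prepended and
    induction follows the merges. *)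
Inductive contracts (good : {set {set T}} -> Prop) : {set {set T}} -> Prop :=
| contracts_done : good [set setT] -> contracts good [set setT]
| contracts_step P Q : good P -> merges P Q -> contracts good Q ->
    contracts good P.

(** As long as the two partitions differ, two parts of [P] lie in a common part of [Q]. Merging them
    stays between [P] and [Q] and lowers the number of parts, on which the induction runs. *)
Lemma contracts_refine (good : {set {set T}} -> Prop) P Q :
  partition P [set: T] -> partition Q [set: T] -> finer P Q ->
  (forall R, partition R [set: T] -> finer P R -> finer R Q -> good R) ->
  contracts good Q -> contracts good P.
Proof.
elim: {P}_.+1 {-2}P (ltnSn #|P|) => // n IH P ltP pP pQ fPQ gd cQ.
have [|nex] := pselect (exists x y, pblock Q x = pblock Q y /\ pblock P x <> pblock P y).
  case=> x [y [eQ nP]].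
  have m : merges P ((pblock P x :|: pblock P y) |: (P :\: [set pblock P x; pblock P y])).
    by exists (pblock P x), (pblock P y); rewrite !pb_in //; split=> //; apply/eqP.
  set R := _ |: _ in m; have [pR cR] := merges_partition pP m.
  have fPR : finer P R.
    by have [X [Y h]] := merges_pblock pP m; move=> z; case: (h z).
  have fRQ : finer R Q.
    move=> z; have := pb_in pR z; rewrite {1}/R in_setU1 => /orP[/eqP e|].
      have : z \in pblock R z by apply: mem_pb.
      rewrite e => zxy; apply/subsetP=> u; rewrite !inE !in_pb // => /orP uxy.
      have {}zxy : pblock Q z = pblock Q y.
        by case/setUP: zxy; rewrite in_pb // => /eqP /(finer_eq pP pQ fPQ) ->.
      by rewrite zxy; case: uxy => /eqP /(finer_eq pP pQ fPQ) ->; rewrite ?eQ.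
    rewrite in_setD => /andP[_ RP].
    by rewrite -(pb_eq pP RP (mem_pb pR z)).
  apply: contracts_step m _; first by apply: gd.
  apply: IH => //; first by lia.
  by move=> S pS fRS; apply: gd => //; apply: finer_trans fRS.
rewrite (_ : P = Q) //; apply: pblock_inj => // x; apply/eqP.
rewrite eqEsubset fPQ /=; apply/subsetP=> y; rewrite !in_pb // => /eqP e.
by apply/eqP; apply: contrapT => ne; apply: nex; exists y, x.
Qed.

Section Kernel.
Variable rT : finType.
Implicit Type f : T -> rT.

Definition kernel f := preim_partition f [set: T].

Lemma kernel_partition f : partition (kernel f) [set: T].
Proof. exact: preim_partitionP. Qed.

Lemma in_pblock_kernel f x y : (y \in pblock (kernel f) x) = (f x == f y).
Proof.
rewrite /kernel /preim_partition pblock_equivalence_partition ?inE //.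
by move=> u v w _ _ _; split=> // /eqP->.
Qed.

End Kernel.

Lemma finer_kernel (rT sT : finType) (f : T -> rT) (g : T -> sT) :
  (forall x y, f x = f y -> g x = g y) -> finer (kernel f) (kernel g).
Proof.
by move=> h x; apply/subsetP=> y; rewrite !in_pblock_kernel => /eqP/h->.
Qed.

Lemma kernel_inj (rT : finType) (f : T -> rT) : injective f ->
  kernel f = [set [set x] | x : T].
Proof.
move=> fI; apply/setP=> X; apply/idP/imsetP=> [XP|[x _ ->]].
  have [x ->] := part_pb (kernel_partition f) XP; exists x => //.
  by apply/setP=> y; rewrite in_pblock_kernel !inE (inj_eq fI) eq_sym.
have <- : pblock (kernel f) x = [set x].
  by apply/setP=> y; rewrite in_pblock_kernel !inE (inj_eq fI) eq_sym.
exact: pb_in (kernel_partition f) x.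
Qed.

Lemma kernel_const (rT : finType) (f : T -> rT) : 0 < #|T| ->
  (forall x y, f x = f y) -> kernel f = [set setT].
Proof.
move=> T0 fC; apply: pblock_inj.
- exact: kernel_partition.
- exact: partition_setT.
move=> x; rewrite (pb_eq (partition_setT T0) (X := setT)) ?inE //.
by apply/setP=> y; rewrite in_pblock_kernel (fC x y) eqxx inE.
Qed.

(* The kernels of [f 0, f 1, ...] need not be one merge apart: every partition
   squeezed between two consecutive ones has to be good. *)
Lemma contracts_kernels (rT : finType) (good : {set {set T}} -> Prop)
    (f : nat -> T -> rT) N :
  0 < #|T| ->
  (forall x y, f N x = f N y) ->
  (forall k x y, f k x = f k y -> f k.+1 x = f k.+1 y) ->
  (forall k R, k <= N -> partition R [set: T] ->
     (forall x y, f k x = f k y -> pblock R x = pblock R y) ->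
     (forall x y, pblock R x = pblock R y -> f k.+1 x = f k.+1 y) -> good R) ->
  contracts good (kernel (f 0)).
Proof.
move=> T0 fN fS gd.
have G k R : k <= N -> partition R [set: T] -> finer (kernel (f k)) R ->
    finer R (kernel (f k.+1)) -> good R.
  move=> kN pR f1 f2; apply: (gd k) => // x y e.
    apply: finer_eq f1 _ => //; first exact: kernel_partition.
    by apply/eqP; rewrite -in_pb ?in_pblock_kernel ?e //; apply: kernel_partition.
  have : y \in pblock (kernel (f k.+1)) x.
    by apply: (subsetP (f2 x)); rewrite in_pb // e.
  by rewrite in_pblock_kernel => /eqP.
(* The chain is built from its end: [k] counts the stages left before [N], where the kernel has a
   single part. *)
have {gd} : forall k, k <= N -> contracts good (kernel (f (N - k))).
  elim=> [|k IH] kN.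
    rewrite subn0 kernel_const //; apply: contracts_done.
    apply: (G N) => //; first exact: partition_setT.
      by move=> x; rewrite kernel_const.
    move=> x; apply/subsetP=> y _; rewrite in_pblock_kernel.
    by apply/eqP/fS.
  have e : N - k = (N - k.+1).+1 by lia.
  have := IH (ltnW kN); rewrite e; apply: contracts_refine.
  - exact: kernel_partition.
  - exact: kernel_partition.
  - exact/finer_kernel/fS.
  - by move=> R pR f1 f2; apply: (G (N - k.+1)) => //; lia.
by move/(_ N (leqnn N)); rewrite subnn.
Qed.

End Partitions.

(** A merge loses exactly one part, so indexing each partition by its number of parts gives a
    partition sequence. *)
Lemma contracts_sequence_width (G : sgraph) (mu : {set {set G}} -> nat) k :
  (0 < #|G| -> contracts (fun P => mu P <= k) [set [set x] | x : G]) ->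
  sequence_width mu <= k.
Proof.
case: (posnP #|G|) => [G0 _|G0 /(_ isT) c].
  (* Without vertices the maximum ranges over no index and is 0. *)
  apply: leq_trans (leq0n k); apply: nat_min_le.
  by have [P psP] := exists_partition_sequence G; exists P; rewrite G0 big_geq.
pose S := [set [set x] | x : G].
have pS : partition S setT.
  by rewrite /S -(@kernel_inj G G id) //; apply: kernel_partition.
have cS : #|S| = #|G| by rewrite card_imset //; apply: set1_inj.
have [F [F1 F2 F3 F4]] : exists F : nat -> {set {set G}},
    [/\ F #|S| = S, F 1 = [set setT],
        forall i, 0 < i <= #|S| -> partition (F i) setT /\ mu (F i) <= k
      & forall i, 0 < i < #|S| -> merges (F i.+1) (F i)].
  rewrite -/S in c; elim: c pS => {S cS} [gd _|P Q gP m cQ IH pP].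
    exists (fun=> [set setT]); rewrite cards1; split=> // i; last by lia.
    by move=> _; split=> //; apply: partition_setT.
  have [pQ cPQ] := merges_partition pP m; have [F [F1 F2 F3 F4]] := IH pQ.
  have Q0 : 0 < #|Q|.
    have [x _] : exists x : G, x \in G by apply/existsP; rewrite -lt0n.
    by apply/card_gt0P; exists (pblock Q x); apply: pb_in.
  exists (fun i => if i == #|P| then P else F i); rewrite -{}cPQ eqxx.
  move: (#|Q|) Q0 F1 F3 F4 => q Q0 F1 F3 F4; split=> //.
  - by case: eqP => // e; lia.
  - move=> i hi; case: eqP => [_|ne] //; apply: F3; lia.
  - move=> i hi; rewrite (ltn_eqF (_ : i < q.+1)); last by lia.
    case: eqP => [e|ne]; last by apply: F4; lia.
    by have -> : i = q; [lia | rewrite F1].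
rewrite cS in F1 F3 F4.
apply: (@leq_trans (\max_(1 <= i < #|G|.+1) mu (F i))).
  apply: nat_min_le; exists F; split=> //; split=> // i hi.
  by case: (F3 i hi).
rewrite big_seq_cond; apply/bigmax_leqP_seq => i _.
by rewrite mem_index_iota andbT => hi; case: (F3 i hi).
Qed.

(** * Path-width bounds total twin-width *)

(** Ties are broken by the enumeration of [T]; since [enum_rank x < #|T|], the key is recovered as a
    quotient by [#|T|]. *)
Lemma injective_rank (T : finType) (key : T -> nat) :
  exists rho : T -> nat,
    injective rho /\ forall x y, rho x < rho y -> key x <= key y.
Proof.
exists (fun x => key x * #|T| + enum_rank x).
have q x : key x = (key x * #|T| + enum_rank x) %/ #|T|.
  have lx := ltn_ord (enum_rank x).
  by rewrite divnMDl ?divn_small ?addn0 //; apply: leq_ltn_trans lx.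
split=> [x y e|x y /ltnW le].
  have ek : key x = key y by rewrite q e -q.
  by move: e; rewrite ek => /addnI/ord_inj/enum_rank_inj.
by rewrite (q x) (q y) leq_div2r.
Qed.

Lemma homogeneousP (G : sgraph) (X Y : {set G}) :
  reflect ((forall x y, x \in X -> y \in Y -> adj x y) \/
           (forall x y, x \in X -> y \in Y -> ~~ adj x y)) (homogeneous X Y).
Proof.
apply: (iffP orP) => -[] h; [left|right|left|right].
- by move=> x y xX yY; move/forall_inP/(_ x xX)/forall_inP/(_ y yY): h.
- by move=> x y xX yY; move/forall_inP/(_ x xX)/forall_inP/(_ y yY): h.
- by apply/forall_inP=> x xX; apply/forall_inP=> y; apply: h.
- by apply/forall_inP=> x xX; apply/forall_inP=> y; apply: h.
Qed.

Lemma homogeneous1 (G : sgraph) (x y : G) : homogeneous [set x] [set y].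
Proof.
apply/homogeneousP; case: (boolP (adj x y)) => h; [left|right];
by move=> u v /set1P-> /set1P->.
Qed.

Lemma homogeneous_sym (G : sgraph) (X Y : {set G}) :
  homogeneous X Y = homogeneous Y X.
Proof.
suff h A B : @homogeneous G A B -> homogeneous B A by apply/idP/idP; apply: h.
case/homogeneousP=> h; apply/homogeneousP; [left|right];
by move=> x y xB yA; rewrite adj_sym; apply: h.
Qed.

Lemma nonhomogeneous_adj (G : sgraph) (X Y : {set G}) :
  ~~ homogeneous X Y -> exists x y, [/\ x \in X, y \in Y & adj x y].
Proof.
move=> nh; apply: contrapT => h; case/negP: nh; apply/homogeneousP; right.
by move=> x y xX yY; apply/negP=> a; apply: h; exists x, y.
Qed.

Lemma red_sym (G : sgraph) : symmetric (@red G).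
Proof.
by move=> X Y; rewrite /red eq_sym homogeneous_sym; case: eqP => // ->.
Qed.

Lemma red_nontrivial (G : sgraph) (X Y : {set G}) :
  (exists x, x \in X) -> (exists y, y \in Y) ->
  red X Y -> 1 < #|X| \/ 1 < #|Y|.
Proof.
move=> /set0Pn X0 /set0Pn Y0; rewrite /red; case: eqP => [_|_ nh]; first by left.
case: (ltnP 1 #|X|) => h1; first by left.
case: (ltnP 1 #|Y|) => h2; first by right.
have /cards1P[x e] : #|X| == 1 by rewrite eqn_leq h1 card_gt0.
have /cards1P[y e'] : #|Y| == 1 by rewrite eqn_leq h2 card_gt0.
by rewrite e e' homogeneous1 in nh.
Qed.

(** A walk in the path graph changes its index by one at each step, so a walk through bags
    containing [x] cannot jump over [l]. *)
Lemma path_decomposition_convex (G : sgraph) n (B : path_graph n -> {set G})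
    x (i j l : path_graph n) :
  decomposition B -> x \in B i -> x \in B j -> i <= l <= j -> x \in B l.
Proof.
case=> _ _ con xi xj /andP[il lj]; apply: contraT => xl.
have {}il : i < l.
  rewrite ltn_neqAle il andbT; apply: contraNneq xl => /val_inj <- //.
suff : j < l by rewrite ltnNge lj.
have /connectP[p] := con x i j xi xj.
elim: p i il {xi} => [|i' p IH] i il /=; first by move=> _ ->.
case/andP=> /and3P[a xi xi'] pth e; apply: (IH i') => //.
have nl : i' != l :> nat by apply: contraNneq xl => /val_inj <-.
by move: a; rewrite /adj /= /path_adj; lia.
Qed.

Lemma path_decomposition_last (G : sgraph) n (B : path_graph n -> {set G}) :
  decomposition B -> exists r : G -> path_graph n,
    (forall x, x \in B (r x)) /\ forall x i, x \in B i -> i <= r x.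
Proof.
move=> dB.
have ex (x : G) : exists i : path_graph n,
    x \in B i /\ forall j : path_graph n, x \in B j -> j <= i.
  have [i0 xi0] : exists i, x \in B i by case: dB.
  case: (@arg_maxnP _ i0 (fun i => x \in B i) val xi0) => i xi imax.
  by exists i; split=> // j /imax.
by have [r rP] := choice ex; exists r; split=> x; case: (rP x).
Qed.

Lemma total_twinwidth_le_pathwidth (G : sgraph) :
  total_twinwidth G <= (pathwidth G).+3.
Proof.
have [n [B [dB wB]]] := pathwidth_decomposition G.
have [r [rB rmax]] := path_decomposition_last dB.
have [rho [rhoI rho_mono]] := injective_rank (fun x => val (r x)).
(* [None] is the part swallowed so far; every other vertex keeps a value of its own. *)
pose f k x := if rho x < k then None else Some x.
apply: (@contracts_sequence_width G (fun P => #|red_edges P|)) => G0.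
have <- : kernel (f 0) = [set [set x] | x : G] by apply: kernel_inj => x y [].
apply: (@contracts_kernels _ _ _ f (\max_x rho x).+1) => //.
- by move=> x y; rewrite /f !ltnS !leq_bigmax.
- move=> k x y; rewrite /f.
  case: (ltnP (rho x) k) => hx; case: (ltnP (rho y) k) => hy //; last by case=> ->.
  by rewrite !ltnS (ltnW hx) (ltnW hy).
move=> k R _ pR hk hk1.
(* Two distinct vertices of a part both have rank at most [k], and only one of them can have rank
   [k]. *)
have big X : X \in R -> 1 < #|X| -> exists2 a, a \in X & rho a < k.
  move=> XR /card_gt1P[x [y [xX yX nxy]]].
  have /hk1 : pblock R x = pblock R y by rewrite !(pb_eq pR XR).
  have := contra_neq (@rhoI x y) nxy.
  rewrite /f; case: (ltnP (rho x) k.+1) => hx; case: (ltnP (rho y) k.+1) => hy //.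
    move=> ne _; case: (ltnP (rho x) k) => hx'; first by exists x.
    by exists y => //; lia.
  by move=> _ [e]; rewrite e eqxx in nxy.
have [[a ha]|na] := pselect (exists a, rho a < k); last first.
  rewrite (_ : red_edges R = set0) ?cards0 //; apply/setP=> E; rewrite inE.
  apply/imset2P=> -[X Y XR]; rewrite inE => /andP[YR rXY] _; apply: na.
  by case: (red_nontrivial (part_neq0 pR XR) (part_neq0 pR YR) rXY) => /big[] // a; exists a.
pose Z := pblock R a.
have bigZ X : X \in R -> 1 < #|X| -> X = Z.
  move=> XR /(big _ XR)[b bX bk]; rewrite -(pb_eq pR XR bX); apply: hk.
  by rewrite /f bk ha.
have inZ x : rho x < k -> x \in Z.
  by move=> xk; rewrite /Z in_pb //; apply/eqP/hk; rewrite /f xk ha.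
have Zk x : x \in Z -> rho x <= k.
  by rewrite /Z in_pb // => /eqP/hk1; rewrite /f (leqW ha) ltnS; case: ifP.
(* [C] holds the vertex of rank [k], which an intermediate partition may or may not have put into
   [Z]; [L] holds the only later vertices that can have a neighbour in [Z]. The vertex [a] accounts
   for the loop at [Z]. *)
pose C := [set y | rho y == k].
pose L := [set y | (k < rho y) && [exists x, (rho x <= k) && adj x y]].
have sub : red_edges R \subset [set [set Z; pblock R y] | y in (a |: C) :|: L].
  have aux Y : Y \in R -> red Z Y ->
      [set Z; Y] \in [set [set Z; pblock R y] | y in (a |: C) :|: L].
    move=> YR rZY; have [->|nYZ] := eqVneq Y Z.
      by apply/imsetP; exists a; rewrite ?inE ?eqxx.
    move: rZY; rewrite /red eq_sym (negPf nYZ).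
    case/nonhomogeneous_adj=> x [y [xZ yY axy]].
    apply/imsetP; exists y; last by rewrite (pb_eq pR YR yY).
    have yZ : y \notin Z.
      by apply: contra nYZ => yZ; rewrite -(pb_eq pR YR yY) -in_pb.
    have ky : k <= rho y by rewrite leqNgt; apply: contra yZ; apply: inZ.
    rewrite !inE; move: ky; rewrite leq_eqVlt => /orP[/eqP->|ky].
      by rewrite eqxx orbT.
    by rewrite ky; apply/orP; right; apply/existsP; exists x; rewrite axy Zk.
  apply/subsetP=> E /imset2P[X Y XR]; rewrite inE => /andP[YR rXY] ->.
  case: (red_nontrivial (part_neq0 pR XR) (part_neq0 pR YR) rXY) => /bigZ e.
    by rewrite (e XR); apply: aux; rewrite // -(e XR).
  by rewrite (e YR) setUC; apply: aux; rewrite // -(e YR) red_sym.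
have cC : #|C| <= 1.
  by apply/card_le1_eqP=> x y; rewrite !inE => /eqP ex /eqP ey; apply: rhoI; rewrite ex ey.
(* With [m] of largest rank at most [k], all of [L] lies in the bag [B (r m)]: a bag shared by [y]
   in [L] and a neighbour of rank at most [k] has index at most [r m], and [r m <= r y], so
   convexity applies. *)
have cL : #|L| <= (pathwidth G).+1.
  have ak : rho a <= k by exact: ltnW.
  case: (@arg_maxnP _ a (fun x => rho x <= k) rho ak) => m mk mmax.
  apply: leq_trans (wB (r m)); apply/subset_leq_card/subsetP=> y.
  rewrite inE => /andP[ky /existsP[x /andP[xk axy]]].
  have rxm : r x <= r m.
    have [->//|nxm] := eqVneq x m; apply: rho_mono.
    by rewrite ltn_neqAle (inj_eq rhoI) nxm; apply: mmax.
  have rmy : r m <= r y by apply: rho_mono; lia.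
  have [i /andP[xi yi]] : exists i, (x \in B i) && (y \in B i).
    by case: dB => _ + _; apply.
  apply: (path_decomposition_convex dB yi (rB y)).
  by rewrite rmy (leq_trans (rmax _ _ xi)).
apply: leq_trans (subset_leq_card sub) _; apply: leq_trans (leq_imset_card _ _) _.
apply: leq_trans (leq_card_setU _ _) _.
rewrite cardsU1; have : nat_of_bool (a \notin C) <= 1 by case: (_ \notin _).
move: cC cL; move: (#|C|) (#|L|) (nat_of_bool _) (pathwidth G); lia.
Qed.

(** * Tree-width bounds component twin-width *)

(** A shortened walk from [j] to [l] avoiding [i] would close up through [i] to a cycle. *)
Lemma acyclic_neighbours (H : sgraph) (i j l : H) :
  (forall c : seq H, 2 < size c -> ~ ucycle (@adj H) c) ->
  adj i j -> adj i l -> j != l ->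
  ~~ connect (fun a b => [&& adj a b, a != i & b != i]) j l.
Proof.
move=> acy aij ail njl; apply/negP=> /connectP[q qp ql].
case: (shortenP qp) ql => s sp su _ ls; apply: (acy (i :: j :: s)).
  by case: s sp su ls => // _ _ e; rewrite e eqxx in njl.
have nji : j != i by apply: contraTneq aij => ->; rewrite adj_irr.
have si : i \notin j :: s.
  elim: s j sp nji {su ls njl aij qp} => [|k s IH] j /=.
    by rewrite inE eq_sym.
  case/andP=> /and3P[_ _ ki] ps ji; rewrite inE negb_or eq_sym ji /=.
  by apply: IH.
apply/andP; split; last by rewrite cons_uniq si.
rewrite /cycle rcons_path /= aij -ls adj_sym ail andbT.
by apply: sub_path sp => a b /andP[].
Qed.

(** [d] is the distance to an arbitrary root and [p i] a neighbour closer to it. Two distinct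
    neighbours of [i] no farther from the root than [i] would be joined through the root outside
    [i], against acyclicity. *)
Lemma tree_rooting (H : sgraph) : is_tree H ->
  exists (d : H -> nat) (p : H -> H),
    (forall i, d (p i) < d i \/ p i = i) /\
    forall i j, adj i j -> (j = p i /\ d j < d i) \/ (i = p j /\ d i < d j).
Proof.
case=> /card_gt0P[r _] con acy.
pose D i k := exists s, [/\ path (@adj H) i s, last i s = r & size s = k].
pose d i := nat_min (D i).
have Dd i : D i (d i).
  apply: nat_min_in; have /connectP[s sp sl] := con i r.
  by exists (size s), s.
have d0 i : d i = 0 -> i = r.
  by have [s [_ + sz]] := Dd i; move=> + e; move: sz; rewrite e; case: s.
have down i : 0 < d i -> exists2 j, adj i j & d j < d i.
  have [s [sp sl sz]] := Dd i; rewrite -{1 2}sz.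
  case: s sp sl {sz} => // j s /andP[aij sp] sl _; exists j => //.
  by apply: nat_min_le; exists s.
(* Every vertex met after [j] on a descent to the root has distance less than [d i], hence differs
   from [i]. *)
have avoid i j : j != i -> d j <= d i ->
    connect (fun a b => [&& adj a b, a != i & b != i]) j r.
  elim: {j}(d j).+1 {-2}j (ltnSn (d j)) => // n IH j le ji dji.
  case: (posnP (d j)) => [/d0->|/down[k ajk dk]]; first exact: connect0.
  have ki : k != i by apply: contraTneq dk => ->; lia.
  apply: connect_trans (IH k _ ki _); [|lia|lia].
  by apply: connect1; rewrite ajk ji.
have uniq_down i j l : adj i j -> adj i l -> d j <= d i -> d l <= d i -> j = l.
  move=> aij ail dj dl; apply/eqP; apply: contraT => njl.
  have /negP[] := acyclic_neighbours acy aij ail njl.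
  have neq k : adj i k -> k != i by apply: contraTneq => ->; rewrite adj_irr.
  apply: connect_trans (avoid i j (neq _ aij) dj) _.
  rewrite sym_connect_sym; first exact: avoid (neq _ ail) dl.
  by move=> a b; rewrite adj_sym andbCA andbC -andbA andbCA.
pose p i := if [pick j | adj i j & d j < d i] is Some j then j else i.
exists d, p; split=> [i|i j aij].
  by rewrite /p; case: pickP => [j /andP[]|]; [left|right].
(* The closer neighbour [c] of [a] must be [b], which also excludes edges between vertices at equal
   distance. *)
have up a b : adj a b -> d b <= d a -> b = p a /\ d b < d a.
  move=> ab dab.
  have /down[c ac dc] : 0 < d a.
    rewrite lt0n; apply: contraTneq ab => da0.
    by rewrite (d0 a da0) (d0 b) ?adj_irr //; lia.
  have eb : b = c by apply: uniq_down ac dab (ltnW dc).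
  rewrite {1}eb; split; last by rewrite eb.
  rewrite /p; case: pickP => [e /andP[ae de]|/(_ c)]; last by rewrite ac dc.
  by apply: uniq_down ac ae (ltnW dc) (ltnW de).
case/orP: (leq_total (d j) (d i)) => h; first by left; apply: up.
by right; apply: up; rewrite // adj_sym.
Qed.

(** [top x] is a node of least depth among those whose bag contains [x]. Along a walk from it, each
    edge either drops the first step of the climb back, which minimality makes nonempty, or prepends
    one. *)
Lemma tree_decomposition_top (G H : sgraph) (B : H -> {set G})
    (d : H -> nat) (p : H -> H) :
  decomposition B ->
  (forall i j, adj i j -> (j = p i /\ d j < d i) \/ (i = p j /\ d i < d j)) ->
  exists top : G -> H, forall x, x \in B (top x) /\
    forall j, x \in B j -> exists2 n, iter n p j = top x &
      forall m, m <= n -> x \in B (iter m p j).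
Proof.
move=> [cov _ con] dp.
suff ex x : exists t, x \in B t /\ forall j, x \in B j ->
    exists2 n, iter n p j = t & forall m, m <= n -> x \in B (iter m p j).
  by have [top topP] := choice ex; exists top.
have [i0 xi0] := cov x.
case: (@arg_minnP _ i0 (fun i => x \in B i) d xi0) => t xt tmin.
exists t; split=> // j xj.
have /connectP[s sp ->] := con x t j xt xj.
elim/last_ind: s sp {xj j} => [|s j IH].
  by exists 0 => // m; rewrite leqn0 => /eqP->.
rewrite rcons_path last_rcons => /andP[/IH{IH}].
move: (last t s) => i [n en hn] /and3P[aij xi xj].
case: (dp _ _ aij) => -[e lt].
  case: n en hn => [|n] en hn.
    by have := tmin j xj; rewrite -en /=; lia.
  exists n; first by rewrite e -iterSr.
  by move=> m mn; rewrite e -iterSr; apply: hn.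
exists n.+1; first by rewrite iterSr -e.
by case=> [|m] mn //; rewrite iterSr -e; apply: hn.
Qed.

(** Vertices are ranked by decreasing depth of [top], and [E] joins vertices sharing a bag. The last
    vertex [M] is joined to all others, so that each of them has a later neighbour; this adds one to
    the bag size in the bound. Later neighbours of [x] other than [M] lie in [B (top x)], whence
    chordality. *)
Lemma elimination_order (G : sgraph) : 0 < #|G| ->
  exists (rho : G -> nat) (E : rel G) (M : G),
    [/\ injective rho,
        forall x y, adj x y -> E x y,
        forall x, x != M -> rho x < rho M /\ E x M,
        forall x, #|[set y | E x y && (rho x < rho y)]| <= (treewidth G).+2
      & symmetric E /\ forall x y z, rho x < rho y -> rho x < rho z ->
          E x y -> E x z -> E y z].
Proof.
move=> /card_gt0P[x0 _].
have [H [B [tH dB wB]]] := treewidth_decomposition G.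
have [d [p [dpi dp]]] := tree_rooting tH.
have [top topP] := tree_decomposition_top dB dp.
have diter n j : d (iter n p j) <= d j /\ (d (iter n p j) = d j -> iter n p j = j).
  elim: n => [//|n [le eq]] /=; case: (dpi (iter n p j)) => [lt|->//].
  by split; lia.
have [rho [rhoI rhoP]] := injective_rank (fun x => \max_i d i - d (top x)).
have {rhoP} rho_d x y : rho x < rho y -> d (top y) <= d (top x).
  move/rhoP; have := @leq_bigmax _ d (top x); have := @leq_bigmax _ d (top y).
  by move: (\max_i d i); lia.
pose S x y := [exists i, (x \in B i) && (y \in B i)].
(* A shared bag climbs to both tops. If [top x] comes no later than [top y], then [y] is still in
   its bag; otherwise [top x] lies above [top y], and the ranks force equal depth, hence
   equality. *)
have S_top x y : S x y -> rho x < rho y -> y \in B (top x).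
  move=> /existsP[i /andP[xi yi]] /rho_d le.
  have [_ /(_ i xi)[n en hn]] := topP x; have [ytop /(_ i yi)[m em hm]] := topP y.
  case: (leqP n m) => nm; first by rewrite -en; apply: hm.
  have [le' eq'] := diter (n - m) (top y).
  have e : iter (n - m) p (top y) = top x.
    by rewrite -em -iterD subnK ?en // ltnW.
  by rewrite -e eq' //; apply/eqP; rewrite eqn_leq le' e.
case: (@arg_maxnP _ x0 predT rho isT) => M _ Mmax.
pose E x y := [|| S x y, x == M | y == M].
have ltM x y : rho x < rho y -> x == M = false.
  by move=> lt; apply: contraTF lt => /eqP->; rewrite -leqNgt; apply: Mmax.
exists rho, E, M; split=> //.
- by move=> x y /(let: And3 _ h _ := dB in h x y)[i xyi]; apply/orP; left; apply/existsP; exists i.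
- move=> x nx; split; last by rewrite /E eqxx !orbT.
  by rewrite ltn_neqAle (inj_eq rhoI) nx; apply: Mmax.
- move=> x; apply: (@leq_trans #|M |: B (top x)|).
    apply/subset_leq_card/subsetP=> y; rewrite !inE => /andP[Exy lt].
    move: Exy; rewrite /E (ltM _ _ lt) /= orbC; case: eqP => //= _ Sxy.
    exact: S_top.
  by rewrite cardsU1 -add1n leq_add //; case: (_ \notin _).
- split=> [x y|x y z xy xz].
    rewrite /E [(x == M) || _]orbC; congr (_ || _).
    by apply/existsP/existsP=> -[i]; exists i; rewrite andbC.
  rewrite /E (ltM _ _ xy) /=; case: eqP => [->|_]; first by rewrite !orbT.
  case: (z =P M) => [_|_]; first by rewrite !orbT.
  rewrite !orbF => /S_top/(_ xy) yt /S_top/(_ xz) zt.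
  by apply/existsP; exists (top x); rewrite yt zt.
Qed.

Lemma card_bigcup_le (I T : finType) (A : {set I}) (F : I -> {set T}) k :
  (forall i, i \in A -> #|F i| <= k) -> #|\bigcup_(i in A) F i| <= #|A| * k.
Proof.
move=> hF; rewrite -sum_nat_const; apply: (@leq_trans (\sum_(i in A) #|F i|)).
  elim/big_rec2: _ => [|i n X _ IH]; first by rewrite cards0.
  by apply: leq_trans (leq_card_setU _ _) _; rewrite leq_add2l.
by apply: leq_sum => i; apply: hF.
Qed.

(** A red component lies in one block of stage [k.+1], which comes from at most two blocks of stage
    [k]. Each of these contributes its root and at most one class per set of later neighbours of the
    root. *)
Lemma component_twinwidth_le_treewidth (G : sgraph) :
  component_twinwidth G <= 2 + 2 * 2 ^ (treewidth G).+2.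
Proof.
apply: (@contracts_sequence_width G (@max_red_component G)) => G0.
have [rho [E [M [rhoI adjE EM cardE [symE chordal]]]]] := elimination_order G0.
(* The parent in the elimination tree is the first later [E]-neighbour; at [M] its value is
   arbitrary. *)
have ex_pi x : exists y, x != M ->
    [/\ E x y, rho x < rho y & forall z, E x z -> rho x < rho z -> rho y <= rho z].
  have [->|nx] := eqVneq x M; first by exists M.
  have [lt ExM] := EM x nx.
  case: (@arg_minnP _ M (fun y => E x y && (rho x < rho y)) rho) => [|y /andP[Ey ly] ymin].
    by rewrite lt ExM.
  by exists y => _; split=> // z Ez lz; apply: ymin; rewrite Ez lz.
have {ex_pi} [pi piP] := choice ex_pi.
(* [rt k x] follows [pi] from [x] until a vertex of rank at least [k]. *)
pose rt k x := iteri k (fun j y => if rho y == j then pi y else y) x.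
have rtS k x : rt k.+1 x = if rho (rt k x) == k then pi (rt k x) else rt k x by [].
have rtS_eq k x y : rt k x = rt k y -> rt k.+1 x = rt k.+1 y.
  by rewrite !rtS => ->.
have rt_ge k x : k <= rho M -> k <= rho (rt k x).
  elim: k => // k IH kM; have := IH (ltnW kM); rewrite rtS.
  case: eqP => [e _|/eqP ne]; last by rewrite ltn_neqAle eq_sym ne.
  by rewrite -{1}e; case: (piP (rt k x)) => //; apply: contraTneq kM => <-; rewrite e ltnn.
have rt_root k x : k <= rho x -> rt k x = x.
  elim: k => // k IH kx; rewrite rtS IH ?(ltnW kx) //.
  by rewrite (gtn_eqF kx).
(* When the block rooted at rank [k] is absorbed by that of its parent, [y] and the parent are both
   later neighbours of the old root, so chordality joins them. *)
have claim k : k <= rho M -> forall u y, E u y -> rt k u <> rt k y ->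
    u <> rt k u -> E (rt k u) y /\ rho (rt k u) < rho y.
  elim: k => [//|k IH] kM u y Euy nrt nu.
  have {}IH := IH (ltnW kM).
  have nrt' : rt k u <> rt k y by move/rtS_eq.
  move: (nrt) (nu); rewrite (rtS k u); case: (rho (rt k u) =P k) => [ek|nk] nrt1 nu1; last first.
    by apply: IH.
  have [E1 lt1] : E (rt k u) y /\ rho (rt k u) < rho y.
    have [e|] := pselect (u = rt k u); last by apply: IH.
    rewrite -e; split=> //; rewrite ltnNge leq_eqVlt; apply/negP=> /orP[/eqP/rhoI ey|lt].
      by apply: nrt'; rewrite ey.
    (* Here [u] is its own root, of rank [k]. An earlier [y] is not a root, so the induction
       hypothesis with [y] and [u] exchanged puts the root of [y] below rank [k], which [rt_ge]
       forbids. *)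
    have ryu : rho (rt k y) < rho u.
      case: (IH y u) => //; first by rewrite symE.
        by move=> /esym.
      by move=> ey; have := rt_ge k y (ltnW kM); rewrite -ey; move: ek; rewrite -e; lia.
    by have := rt_ge k y (ltnW kM); move: ek; rewrite -e; lia.
  have nM : rt k u != M by apply: contraTneq kM => <-; rewrite ek ltnn.
  have [Ep lp pmin] := piP _ nM.
  have ney : rho (pi (rt k u)) != rho y.
    apply: contra_not_neq nrt1 => /rhoI e.
    by rewrite -e (rt_root k.+1) //; move: lp; rewrite ek.
  have lty : rho (pi (rt k u)) < rho y by rewrite ltn_neqAle ney pmin.
  by split=> //; apply: (chordal (rt k u)).
(* The signature of [u]: the root of its block and its neighbours outside the block. *)
pose tau k u := (rt k u, [set y | adj u y && (rt k y != rt k u)]).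
have tau_adj k x y z : tau k x = tau k y -> rt k z <> rt k x -> adj x z = adj y z.
  case=> er /setP/(_ z) + /eqP nz; rewrite !inE er.
  by move: nz; rewrite er => ->; rewrite !andbT.
have rtM x : rt (rho M) x = M.
  apply/eqP; apply: contraT => /EM[lt _].
  by have := rt_ge _ x (leqnn (rho M)); rewrite leqNgt lt.
have <- : kernel (tau 0) = [set [set x] | x : G] by apply: kernel_inj => x y [].
apply: (@contracts_kernels _ _ _ tau (rho M)) => //.
- move=> x y; rewrite /tau !rtM; congr (_, _).
  by apply/setP=> z; rewrite !inE rtM eqxx !andbF.
- move=> k x y e; have [er _] := e; rewrite /tau (rtS_eq _ _ _ er); congr (_, _).
  apply/setP=> z; rewrite !inE; case: eqP => [_|nz]; first by rewrite !andbF.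
  rewrite (tau_adj k x y) // => ez.
  by apply: nz; rewrite (rtS_eq _ _ _ ez); apply: rtS_eq.
move=> k R kM pR hk hk1; apply/bigmax_leqP=> X XR.
(* Between distinct blocks of stage [k.+1], adjacency depends only on the signatures, which are
   constant on each part of [R]. *)
have step Y Z y z : Y \in R -> Z \in R -> red Y Z -> y \in Y -> z \in Z ->
    rt k.+1 y = rt k.+1 z.
  move=> YR ZR rYZ yY zZ; apply: contrapT => nyz.
  have tY y' : y' \in Y -> tau k.+1 y' = tau k.+1 y.
    by move=> y'Y; apply: hk1; rewrite !(pb_eq pR YR).
  have tZ z' : z' \in Z -> tau k.+1 z' = tau k.+1 z.
    by move=> z'Z; apply: hk1; rewrite !(pb_eq pR ZR).
  move: rYZ; rewrite /red; case: eqP => [e _|_ /negP[]].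
    by apply: nyz; rewrite e in yY; case: (tZ y yY).
  suff h y' z' : y' \in Y -> z' \in Z -> adj y' z' = adj y z.
    by apply/homogeneousP; case: (boolP (adj y z)) => a; [left|right] => y' z' h1 h2;
      rewrite h.
  move=> /tY ty /tZ tz; have ery : rt k.+1 y' = rt k.+1 y := congr1 fst ty.
  have erz : rt k.+1 z' = rt k.+1 z := congr1 fst tz.
  rewrite (tau_adj _ _ _ _ ty); last by rewrite ery erz => /esym.
  by rewrite adj_sym (tau_adj _ _ _ _ tz) ?erz // adj_sym.
have [x xX] := part_neq0 pR XR; pose v := rt k.+1 x.
have comp Y : Y \in R -> connect (red_adj R) X Y -> forall y, y \in Y -> rt k.+1 y = v.
  move=> _ /connectP[s sp ->]; elim/last_ind: s sp => [_ y yX|s Z IH] /=.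
    by have /hk1[] : pblock R y = pblock R x by rewrite !(pb_eq pR XR).
  rewrite rcons_path last_rcons => /andP[/IH{}IH /and3P[YR ZR rYZ]] z zZ.
  have [y yY] := part_neq0 pR YR.
  by rewrite -(IH y yY); apply/esym/(step _ _ _ _ YR ZR).
set C := [set _ in _ | _].
(* [S] contains every root at stage [k] that can lead to [v] at stage [k.+1]. [W] collects the
   possible signatures: those of the roots themselves, and those given by [claim] for the other
   vertices. *)
pose S := v |: [set z | rho z == k].
pose L z := [set y | E z y && (rho z < rho y)].
pose W := [set tau k z | z in S] :|: \bigcup_(z in S) [set (z, A) | A in powerset (L z)].
pose rep (Y : {set G}) := odflt x [pick y in Y].
have repP Y : Y \in R -> rep Y \in Y.
  move=> /(part_neq0 pR)[y yY]; rewrite /rep; case: pickP => //= /(_ y).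
  by rewrite yY.
have rep_inj : {in C &, injective (fun Y => tau k (rep Y))}.
  move=> Y Z; rewrite !inE => /andP[YR _] /andP[ZR _] /hk.
  by rewrite (pb_eq pR YR (repP _ YR)) (pb_eq pR ZR (repP _ ZR)).
rewrite -(card_in_imset rep_inj).
have cS : #|S| <= 2.
  rewrite cardsU1 (leq_add (n1 := 1)) //; first by case: (_ \notin _).
  by apply/card_le1_eqP=> a b; rewrite !inE => /eqP ea /eqP eb; apply: rhoI; rewrite ea eb.
apply: (@leq_trans #|W|).
  apply/subset_leq_card/subsetP=> _ /imsetP[Y + ->].
  rewrite inE => /andP[YR cXY]; have := comp Y YR cXY _ (repP Y YR).
  move: (rep Y) => u uv.
  have rS : rt k u \in S.
    rewrite !inE; move: uv; rewrite rtS; case: eqP => [_|_ ->]; last by rewrite eqxx.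
    by rewrite orbT.
  rewrite inE; apply/orP; have [eu|nu] := eqVneq u (rt k u).
    by left; apply/imsetP; exists (rt k u); rewrite // -eu.
  right; apply/bigcupP; exists (rt k u) => //; apply: imset_f.
  rewrite inE; apply/subsetP=> y; rewrite !inE => /andP[/adjE Euy nr].
  have [|||-> ->//] := claim k kM u y => //; last exact/eqP.
  by move=> e; rewrite e eqxx in nr.
apply: leq_trans (leq_card_setU _ _) _; apply: leq_add.
  exact: leq_trans (leq_imset_card _ _) cS.
apply: (@leq_trans (#|S| * 2 ^ (treewidth G).+2)); last by rewrite leq_mul2r cS orbT.
apply: card_bigcup_le => z _; apply: leq_trans (leq_imset_card _ _) _.
by rewrite card_powerset leq_exp2l //; apply: cardE.
Qed.

(** * Decompositions from partition sequences *)

Section ParentTree.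
Variables (N : finType) (p : N -> N) (d : N -> nat) (r : N).
Hypothesis dp : forall i, i != r -> d (p i) < d i.

Definition parent_adj : rel N :=
  fun i j => ((i != r) && (p i == j)) || ((j != r) && (p j == i)).

Lemma parent_adj_sym : symmetric parent_adj.
Proof. by move=> i j; rewrite /parent_adj orbC. Qed.

Lemma parent_adj_irr : irreflexive parent_adj.
Proof.
move=> i; rewrite /parent_adj orbb; apply/negP=> /andP[/dp + /eqP e].
by rewrite e ltnn.
Qed.

Definition parent_graph : sgraph := SGraph parent_adj_sym parent_adj_irr.

(** Iterating [p] leads to [r]. On a cycle, a node of largest depth would have both its distinct
    cycle neighbours equal to its parent. *)
Lemma parent_graph_tree : is_tree parent_graph.
Proof.
have conr (i : N) : connect parent_adj i r.
  elim: {i}(d i).+1 {-2}i (ltnSn (d i)) => // n IH i le.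
  have [->|ir] := eqVneq i r; first exact: connect0.
  apply: connect_trans (IH (p i) _); last by have := dp ir; lia.
  by apply: connect1; rewrite /parent_adj ir eqxx.
split; first by apply/card_gt0P; exists r.
- move=> i j; apply: connect_trans (conr i) _.
  by rewrite (sym_connect_sym parent_adj_sym) conr.
- move=> c sz /andP[cyc un].
  have [i0 i0c] : exists i0, i0 \in c by case: c sz {cyc un} => // i c; exists i; rewrite inE eqxx.
  case: (@arg_maxnP _ i0 (fun i => i \in c) d i0c) => i ic imax.
  have up j : j \in c -> parent_adj i j -> j = p i.
    move=> jc /orP[/andP[_ /eqP//]|/andP[/dp lt /eqP e]].
    by have := imax j jc; rewrite /= leqNgt -{1}e lt.
  have [m c' ec] := rot_to ic.
  have mem j : j \in i :: c' -> j \in c by rewrite -ec mem_rot.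
  move: cyc un sz; rewrite -(rot_cycle m) -(rot_uniq m) -(size_rot m) ec.
  case: c' {ec} mem => [//|a [//|b s]] mem.
  rewrite /= rcons_path /= => /and4P[ia _ _ li] /and4P[_ nab _ _] _.
  have ea : a = p i by apply: up ia; apply: mem; rewrite !inE eqxx orbT.
  have el : last b s = p i.
    apply: up; last by rewrite parent_adj_sym.
    by apply: mem; rewrite !inE -in_cons mem_last !orbT.
  by rewrite ea -el mem_last in nab.
Qed.

End ParentTree.

(** Otherwise [t] vertices from each side embed the biclique; the two sides are disjoint because
    adjacency is irreflexive. *)
Lemma biclique_free (G : sgraph) t (X Y : {set G}) :
  ~ subgraph (complete_bipartite t t) G ->
  (forall x y, x \in X -> y \in Y -> adj x y) -> t <= #|X| -> #|Y| < t.
Proof.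
move=> nK aXY tX; rewrite ltnNge; apply/negP=> tY; apply: nK.
pose h (s : complete_bipartite t t) : G :=
  match s with
  | inl i => enum_val (widen_ord tX i)
  | inr j => enum_val (widen_ord tY j)
  end.
have a i j : adj (h (inl i)) (h (inr j)) by apply: aXY; apply: enum_valP.
exists h; last by case=> i [] j //= _; rewrite ?[adj (enum_val (widen_ord tY i)) _]adj_sym; apply: a.
case=> i [] j e.
- by move/enum_val_inj: e => [/val_inj->].
- by have := a i j; rewrite e adj_irr.
- by have := a j i; rewrite e adj_irr.
- by move/enum_val_inj: e => [/val_inj->].
Qed.

(** The search goes down from [n] and stops at the first index satisfying [Q], or at 1. As merging
    lowers the index, this finds the moment when a vertex becomes big. *)
Lemma last_true_index (Q : pred nat) n : 0 < n -> ~~ Q n.+1 ->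
  exists i, [/\ 0 < i <= n, ~~ Q i.+1 & i = 1 \/ Q i].
Proof.
elim: n => // n IH _ nQ; case: (boolP (Q n.+1)) => Qn.
  by exists n.+1; split=> //; [lia | right].
case: (posnP n) => [e|n0]; first by exists 1; rewrite e in nQ *; split=> //; left.
by have [i [hi h1 h2]] := IH n0 Qn; exists i; split=> //; lia.
Qed.

Section WidthsFromContractions.
Variables (G : sgraph) (t : nat) (P : nat -> {set {set G}}).
Hypotheses (t_gt0 : 0 < t) (Kfree : ~ subgraph (complete_bipartite t t) G).
Hypothesis psP : partition_sequence P.

Let n := #|G|.
Let pb i v := pblock (P i) v.
(** The range condition makes [big] false at [n.+1], an index where [P] is unconstrained but which
    the bags at time [n] mention. *)
Let big i v := (0 < i <= n) && (t < #|pb i v|).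

Let partP i : 0 < i <= n -> partition (P i) [set: G].
Proof. by case: psP => h _ _ _; apply: h. Qed.

Let pbS i v : 0 < i < n -> pb i.+1 v \subset pb i v.
Proof.
case: psP => _ _ _ m hi.
have pi : partition (P i.+1) [set: G] by apply: partP; rewrite /n in hi *; lia.
by have [X [Y h]] := merges_pblock pi (m i hi); case: (h v).
Qed.

Let bigS i v : 0 < i -> big i.+1 v -> big i v.
Proof.
move=> i0 /andP[hi lt]; apply/andP; split; first by lia.
by apply: leq_trans lt (subset_leq_card (pbS _ _)); lia.
Qed.

Let big_mono i j v : 0 < i -> i <= j -> big j v -> big i v.
Proof.
move=> i0 ij; rewrite -(subnK ij); elim: (j - i) => // k IH.
by rewrite addSn => /bigS h; apply: IH; apply: h; lia.
Qed.

Let pb1 u v : 0 < n -> pb 1 u = pb 1 v.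
Proof.
case: psP => _ _ e1 _ n0.
have h w : pb 1 w = setT by apply: pb_eq; rewrite ?inE ?e1 ?set11 // -e1 partP.
by rewrite !h.
Qed.

Let pbn v : pb n v = [set v].
Proof.
case: psP => h en _ _; have n0 : 0 < n by apply/card_gt0P; exists v.
by apply: pb_eq; rewrite ?set11 ?en ?imset_f // -en partP // n0 leqnn.
Qed.

(** Only the two merged parts change, and a newly big vertex comes from one of them with at most [t]
    vertices. At time [n] all parts are singletons. *)
Let newly_big i : 0 < i <= n -> #|[set v | big i v && ~~ big i.+1 v]| <= 2 * t.
Proof.
move=> hi; have [e|ne] := eqVneq i n.
  rewrite (_ : [set v | _] = set0) ?cards0 //; apply/setP=> v.
  by rewrite !inE e /big pbn cards1 (_ : t < 1 = false) ?andbF //; lia.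
have {}ne : i < n by rewrite ltn_neqAle ne; case/andP: hi.
case: psP => _ _ _ /(_ i) m.
have pS : partition (P i.+1) [set: G] by apply: partP.
have [|X [Y h]] := merges_pblock pS (m _); first by case/andP: hi => ->.
pose F (Z : {set G}) := if #|Z| <= t then Z else set0.
apply: (@leq_trans #|\bigcup_(Z in [set X; Y]) F Z|).
  apply/subset_leq_card/subsetP=> v; rewrite inE /big hi ne /= -leqNgt => /andP[lt le].
  have [_ [inXY|e]] := h v; last by move: lt le; rewrite /pb e; lia.
  by apply/bigcupP; exists (pb i.+1 v); rewrite // /F le; apply: mem_pb.
apply: (@leq_trans (#|[set X; Y]| * t)).
  by apply: card_bigcup_le => Z _; rewrite /F; case: (leqP #|Z| t) => //; rewrite cards0.
by rewrite leq_mul2r cards2; case: (X != Y); rewrite ?orbT.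
Qed.

Let small (X : {set G}) := if #|X| <= t then X else set0.
Let complete (X : {set G}) :=
  if t < #|X| then [set v | [forall x in X, adj x v]] else set0.

Let card_small X : #|small X| <= t.
Proof. by rewrite /small; case: (leqP #|X| t) => //; rewrite cards0. Qed.

Let card_complete X : #|complete X| <= t.
Proof.
rewrite /complete; case: ltnP => [lt|_]; last by rewrite cards0.
apply/ltnW/(biclique_free (X := X) Kfree _ (ltnW lt)) => x y xX.
by rewrite inE => /forall_inP; apply.
Qed.

(** A bag is covered by at most [2 * t] newly big vertices and, for each of at most [k] nontrivial
    parts, at most [t] vertices of the part if it is small, [k] singletons red to it, and [t]
    vertices complete to it if it is big. *)
Lemma pathwidth_le_total k : 1 < n ->
  (forall i, 0 < i <= n -> #|red_edges (P i)| <= k) ->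
  pathwidth G <= 2 * t + k * (t + k + t).
Proof.
move=> n1 redk.
pose act i v := (1 < #|pb i v|) || [exists u, adj u v && big i u].
have actS i v : 0 < i < n -> act i.+1 v -> act i v.
  move=> hi /orP[lt|/existsP[u /andP[auv bu]]]; apply/orP; [left|right].
    by apply: leq_trans lt (subset_leq_card (pbS _ _)).
  by apply/existsP; exists u; rewrite auv bigS //; case/andP: hi.
have act_mono i j v : 0 < i -> i <= j -> j <= n -> act j v -> act i v.
  move=> i0 ij; rewrite -(subnK ij); elim: (j - i) => // l IH.
  by rewrite addSn => hl /actS h; apply: IH; [lia|apply: h; lia].
have act1 v : act 1 v.
  apply/orP; left; case: psP => _ _ e1 _.
  have -> : pb 1 v = setT.
    by apply: pb_eq; rewrite ?inE ?e1 ?set11 // -e1 partP //; lia.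
  by rewrite cardsT.
(* Position [i] on the path stands for time [i.+1]; index [i.+2] is the partition just before. *)
pose B (i : path_graph n.-1) := [set v | ~~ big i.+2 v && act i.+1 v].
have ordn (i : path_graph n.-1) : i < n.
  by apply: leq_trans (ltn_ord i) _; rewrite prednK // ltnW.
(* The chosen time is when [u] or [v] first becomes big, since a big endpoint activates the other;
   if neither ever does, time 1 works, where every vertex is active. *)
have pick u v : u = v \/ adj u v -> exists i, (u \in B i) && (v \in B i).
  move=> auv.
  have [||i [hi nQ Qi]] := @last_true_index (fun i => big i u || big i v) n.
  - exact: ltnW.
  - by rewrite /big ltnn andbF.
  have hi' : i.-1 < n.-1.+1 by lia.
  exists (Ordinal hi'); rewrite !inE /= !prednK; last by case/andP: hi.
  move: nQ; rewrite negb_or => /andP[-> ->] /=.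
  case: Qi => [->|Qi]; first by rewrite !act1.
  have bact w : big i w -> act i w.
    by move=> /andP[_ lt]; apply/orP; left; apply: leq_trans lt.
  have nact w w' : adj w w' -> big i w -> act i w'.
    by move=> a b; apply/orP; right; apply/existsP; exists w; rewrite a b.
  case: auv Qi => [->|a /orP[b|b]]; first by rewrite orbb => /bact->.
    by rewrite bact // (nact _ _ a b).
  by rewrite (nact v u) ?bact // adj_sym.
have conv (x : G) (i j l : path_graph n.-1) :
    x \in B i -> x \in B j -> i <= l <= j -> x \in B l.
  rewrite !inE => /andP[nb _] /andP[_ ac] /andP[il lj]; apply/andP; split.
    by apply: contra nb; apply: big_mono.
  by apply: act_mono ac.
have dB : decomposition B.
  split=> [x|x y axy|x i j xi xj].
  - by have [|i /andP[]] := pick x x; [left|exists i].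
  - by apply: pick; right.
  pose R (k l : path_graph n.-1) := [&& adj k l, x \in B k & x \in B l].
  suff h (a b : path_graph n.-1) : a <= b -> x \in B a -> x \in B b -> connect R a b.
    case/orP: (leq_total i j) => ij; first exact: h.
    rewrite -/R sym_connect_sym; first exact: h.
    by move=> a b; rewrite /R adj_sym andbCA andbC -andbA andbCA.
  move: {-2}(b - a) (erefl (b - a)) => m; elim: m a => [|m IH] a eab ab xa xb.
    by rewrite (_ : a = b) ?connect0 //; apply: val_inj; move=> /=; lia.
  have ha : a.+1 < n.-1.+1 by apply: leq_ltn_trans (ltn_ord b); lia.
  have xa' : x \in B (Ordinal ha) by apply: conv xa xb _ => /=; lia.
  apply: connect_trans (IH (Ordinal ha) _ _ xa' xb); rewrite /=; try lia.
  by apply: connect1; rewrite /R xa xa' /adj /= /path_adj /= eqxx.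
apply: pathwidth_le dB _ => j; apply: leqW.
have hi : 0 < j.+1 <= n by rewrite ordn.
set i := j.+1 in hi; have pP := partP hi.
pose NS := [set X in P i | 1 < #|X|].
pose rd X := [set v | [&& [set v] \in P i, [set v] != X & ~~ homogeneous X [set v]]].
apply: (@leq_trans #|[set v | big i v && ~~ big i.+1 v] :|:
    \bigcup_(X in NS) (small X :|: rd X :|: complete X)|).
  apply/subset_leq_card/subsetP=> v; rewrite !inE -/i => /andP[nb ac].
  rewrite nb andbT; case: (boolP (big i v)) => //= nbi; apply/bigcupP.
  move: nbi; rewrite /big hi -leqNgt => le.
  case: (ltnP 1 #|pb i v|) => h.
    exists (pb i v); first by rewrite inE h andbT pb_in.
    by rewrite !inE /small le mem_pb.
  have ev : pb i v = [set v].
    by apply/esym/eqP; rewrite eqEcard sub1set cards1 h andbT mem_pb.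
  move: ac; rewrite /act ltnNge h /= => /existsP[u /andP[auv /andP[_ bu]]].
  exists (pb i u); first by rewrite inE pb_in //=; apply: leq_trans bu.
  have uu : u \in pb i u by apply: mem_pb.
  rewrite !inE /complete bu; case: (boolP (homogeneous (pb i u) [set v])) => [|nh].
    case/homogeneousP=> hom.
      apply/orP; right; rewrite inE; apply/forall_inP=> x xu.
      by apply: hom; rewrite // set11.
    by have := hom u v uu (set11 v); rewrite auv.
  rewrite -{1}ev pb_in // andbT (_ : _ != _) ?orbT //.
  by apply: contraTneq bu => <-; rewrite cards1 -leqNgt.
apply: leq_trans (leq_card_setU _ _) _; apply: leq_add; first exact: newly_big.
(* The red loops count the nontrivial parts. *)
have cN : #|NS| <= k.
  apply: leq_trans (redk i hi).
  rewrite -(card_in_imset (f := fun X => [set X])); last by move=> X Y _ _ /set1_inj.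
  apply/subset_leq_card/subsetP=> _ /imsetP[X + ->]; rewrite inE => /andP[XP X1].
  by apply/imset2P; exists X X; rewrite ?inE ?XP ?setUid //= /red eqxx.
apply: (@leq_trans (#|NS| * (t + k + t))); last by rewrite leq_mul2r cN orbT.
apply: card_bigcup_le => X; rewrite inE => /andP[XP _].
apply: leq_trans (leq_card_setU _ _) _; apply: leq_add (card_complete _).
apply: leq_trans (leq_card_setU _ _) _; apply: leq_add; first exact: card_small.
apply: leq_trans (redk i hi).
rewrite -(card_in_imset (f := fun v => [set X; [set v]])).
  apply/subset_leq_card/subsetP=> _ /imsetP[v + ->]; rewrite inE => /and3P[vP nX nh].
  by apply/imset2P; exists X [set v]; rewrite ?inE ?vP //= /red eq_sym (negPf nX).
move=> v w; rewrite !inE => /and3P[_ nX _] _ /setP/(_ [set v]).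
by rewrite !inE eqxx orbT (negPf nX) /= => /esym/eqP/set1_inj.
Qed.

(** Red connectivity carried over to vertices, so that each red component has a canonical vertex
    [rep i v] to label a tree node. *)
Let link i : rel G :=
  fun u v => (pb i u == pb i v) || ~~ homogeneous (pb i u) (pb i v).
Let rep i v := root (link i) v.

Let link_sym i : connect_sym (link i).
Proof.
by apply: sym_connect_sym => u v; rewrite /link eq_sym homogeneous_sym.
Qed.

Let link_rep i u v : connect (link i) u v -> rep i u = rep i v.
Proof. by move=> c; apply/eqP; rewrite (root_connect (@link_sym i)). Qed.

Let linkS i u v : 0 < i < n -> link i.+1 u v -> link i u v.
Proof.
move=> hi; have pS : partition (P i.+1) [set: G] by apply: partP; lia.
have pi : partition (P i) [set: G] by apply: partP; lia.
move=> /orP[/eqP e|nh]; apply/orP; [left|right].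
  rewrite -(in_pb pi); apply: (subsetP (pbS v hi)).
  by rewrite /pb in_pb //; apply/eqP.
apply: contra nh => /homogeneousP hom; apply/homogeneousP.
case: hom => hom; [left|right] => x y xu yv;
by apply: hom; apply: (subsetP (pbS _ hi)).
Qed.

Let connectS i u v : 0 < i < n -> connect (link i.+1) u v -> connect (link i) u v.
Proof.
by move=> hi; apply: connect_sub => a b /(linkS hi); apply: connect1.
Qed.

Let repS i u v : 0 < i < n -> rep i.+1 u = v -> rep i u = rep i v.
Proof. by move=> hi <-; apply/link_rep/connectS/connect_root. Qed.

(** Complete adjacency between the two parts would contain a biclique, and the edge [u v] excludes
    the empty case. *)
Let big_link i u v : adj u v -> big i u -> big i v -> link i u v.
Proof.
move=> auv /andP[hi bu] /andP[_ bv]; have pi := partP hi.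
apply/orP; right; apply/negP=> /homogeneousP[] hom.
  by have := biclique_free Kfree hom (ltnW bu); rewrite ltnNge ltnW.
by have := hom u v; rewrite auv !mem_pb // => /(_ isT isT).
Qed.

Let connect_red i u v : 0 < i <= n -> connect (link i) u v ->
  connect (red_adj (P i)) (pb i u) (pb i v).
Proof.
move=> hi /connectP[s sp ->]; elim: s u sp => [|w s IH] u /=.
  by rewrite connect0.
case/andP=> uw /IH; have [-> //|ne] := eqVneq (pb i u) (pb i w).
apply: connect_trans; apply: connect1.
move: uw; rewrite /link (negPf ne) /= => nh.
by rewrite /red_adj /red (negPf ne) nh !pb_in //; apply: partP.
Qed.

(* The node [Some (i, c)] stands for time [i.+1] and the red component with
   representative [c]; its bag is empty when [c] represents no component. *)
Lemma treewidth_le_component k : 0 < n ->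
  (forall i, 0 < i <= n -> max_red_component (P i) <= k) ->
  treewidth G <= 2 * t + k * (t + t).
Proof.
move=> n0 redk.
pose N := option ('I_n.-1.+1 * G).
(* The parent of a node at time [i.+1] is at time [i], hence [rep i c]. The root [None], with empty
   bag, gathers the nodes of time 1. *)
pose p (a : N) : N :=
  if a is Some (i, c) then
    if i == 0 :> nat then None else Some (inord i.-1, rep i c)
  else None.
pose d (a : N) := if a is Some (i, _) then i.+1 else 0.
have dp (a : N) : a != None -> d (p a) < d a.
  case: a => // -[i c] _ /=; case: eqP => //= i0.
  by rewrite inordK; have := ltn_ord i; lia.
pose H := parent_graph dp.
pose B (a : H) : {set G} := if a is Some (i, c) then
  [set v | ~~ big i.+2 v && ((rep i.+1 v == c) ||
    [exists u, [&& adj u v, big i.+1 u & rep i.+1 u == c]])] else set0.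
have ordn (i : 'I_n.-1.+1) : i < n.
  by apply: leq_trans (ltn_ord i) _; rewrite prednK.
have rep1 u v : rep 1 u = rep 1 v.
  by apply/link_rep/connect1; rewrite /link (pb1 u v) // eqxx.
have big_rep i u v : adj u v -> big i u -> big i v -> rep i u = rep i v.
  by move=> a bu bv; apply/link_rep/connect1/big_link.
have pick u v : u = v \/ adj u v -> exists i, (u \in B i) && (v \in B i).
  move=> auv.
  have [||i [hi nQ Qi]] := @last_true_index (fun i => big i u || big i v) n.
  - exact: n0.
  - by rewrite /big ltnn andbF.
  have hi' : i.-1 < n.-1.+1 by lia.
  have ei : i.-1.+1 = i by lia.
  (* A big endpoint, if there is one, determines the component whose bag receives the edge. *)
  pose w := if big i v then v else u.
  exists (Some (Ordinal hi', rep i w)); rewrite !inE /= ei.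
  move: nQ; rewrite negb_or => /andP[-> ->] /=.
  case: Qi => [->|Qi]; first by rewrite !(rep1 _ w) eqxx.
  have nb x y : adj x y -> big i x -> [exists z, [&& adj z y, big i z & rep i z == rep i x]].
    by move=> a b; apply/existsP; exists x; rewrite a b eqxx.
  case: auv => [e|a]; first by rewrite /w e; case: ifP => _; rewrite eqxx.
  rewrite /w; case: ifP Qi => [bv _|bv]; last first.
    by rewrite orbF => bu; rewrite eqxx (nb _ _ a bu) orbT.
  by rewrite eqxx (nb _ _ _ bv) ?orbT // adj_sym.
have dB : decomposition B.
  split=> [x|x y axy|x a b xa xb].
  - by have [|i /andP[]] := pick x x; [left|exists i].
  - by apply: pick; right.
  pose R (k l : H) := [&& adj k l, x \in B k & x \in B l].
  (* At time [s], when [x] becomes big or everything is one part, only the component of [x] has [x]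
     in its bag, as big neighbours of a big [x] share its component. All other nodes containing [x]
     climb to this one. *)
  have [||s [hs nb bs]] := @last_true_index (big^~ x) n => //.
    by rewrite /big ltnn andbF.
  suff top (c : H) : x \in B c -> connect R c (Some (inord s.-1, rep s x)).
    apply: connect_trans (top a xa) _; rewrite -/R sym_connect_sym; first exact: top.
    by move=> e f; rewrite /R adj_sym andbCA andbC -andbA andbCA.
  case: c => [[j c]|]; last by rewrite inE.
  elim: {j}(val j).+1 {-2}j (ltnSn j) c => // m IH j jm c xc.
  move: (xc); rewrite inE => /andP[nbj xj].
  have js : s <= j.+1.
    rewrite leqNgt; apply/negP=> js; case/negP: nbj.
    by case: bs => [e|]; [lia | apply: big_mono].
  have [es|ns] := eqVneq s j.+1.
    have -> : inord s.-1 = j by rewrite es; apply: val_inj; rewrite /= inordK.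
    suff -> : c = rep s x by exact: connect0.
    rewrite -es in xj; case/orP: xj => [/eqP//|/existsP[u /and3P[aux bu /eqP<-]]].
    by case: bs => [->|bx]; [apply: rep1 | apply: big_rep].
  have nbx : ~~ big j.+1 x by apply: contra nb; apply: big_mono; lia.
  have hj : 0 < j < n by rewrite ordn andbT; lia.
  have j0 : (j == 0 :> nat) = false by lia.
  have vj : (inord j.-1 : 'I_n.-1.+1) = j.-1 :> nat.
    by rewrite inordK //; have := ltn_ord j; lia.
  have ej : j.-1.+1 = j by lia.
  have xp : x \in B (Some (inord j.-1, rep j c)).
    rewrite inE vj ej nbx /=; case/orP: xj => [/eqP e|/existsP[u /and3P[aux bu /eqP e]]].
      by rewrite (repS hj e) eqxx.
    apply/orP; right; apply/existsP; exists u; rewrite aux (repS hj e) eqxx andbT.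
    by apply: bigS => //; case/andP: hj.
  apply: connect_trans (IH (inord j.-1) _ _ xp); last by rewrite vj; lia.
  apply: connect1; apply/and3P; split=> //.
  by rewrite /adj /= /parent_adj /= j0 eqxx.
apply: (treewidth_le (parent_graph_tree dp) dB) => -[[j c]|]; last by rewrite cards0.
apply: leqW; have hi : 0 < j.+1 <= n by rewrite ordn.
rewrite /B; set i := j.+1 in hi *; have pP := partP hi.
pose K := [set X in P i | [exists v in X, rep i v == c]].
apply: (@leq_trans #|[set v | big i v && ~~ big i.+1 v] :|:
    \bigcup_(X in K) (small X :|: complete X)|).
  apply/subset_leq_card/subsetP=> v; rewrite !inE => /andP[nb vc].
  rewrite nb andbT; case: (boolP (big i v)) => //= nbi; apply/bigcupP.
  move: nbi; rewrite /big hi -leqNgt => le.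
  have inK u : rep i u = c -> pb i u \in K.
    move=> e; rewrite inE pb_in //=; apply/existsP; exists u.
    by rewrite mem_pb //= e eqxx.
  have smallv : rep i v = c -> exists2 X, X \in K & v \in small X :|: complete X.
    move=> e; exists (pb i v); first exact: inK.
    by rewrite inE /small le mem_pb.
  case/orP: vc => [/eqP/smallv//|/existsP[u /and3P[auv /andP[_ bu] /eqP e]]].
  case: (boolP (link i u v)) => [/connect1/link_rep e'|]; first by apply: smallv; rewrite -e'.
  (* Unlinked parts are homogeneous, so the edge makes [v] complete to the big part of [u]. *)
  rewrite negb_or negbK => /andP[_ /homogeneousP[] hom]; last first.
    by have := hom u v; rewrite auv !mem_pb // => /(_ isT isT).
  exists (pb i u); first exact: inK.
  rewrite inE /complete bu; apply/orP; right; rewrite inE; apply/forall_inP=> x xu.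
  by apply: hom; rewrite // mem_pb.
apply: leq_trans (leq_card_setU _ _) _; apply: leq_add; first exact: newly_big.
have cK : #|K| <= k.
  have [->|[X]] := set_0Vmem K; first by rewrite cards0.
  rewrite inE => /andP[XP /existsP[x /andP[xX /eqP ex]]].
  apply: leq_trans (redk i hi).
  apply: leq_trans (leq_bigmax_cond (P := mem (P i)) _ XP).
  apply/subset_leq_card/subsetP=> Y; rewrite !inE => /andP[YP /existsP[y /andP[yY /eqP ey]]].
  rewrite YP -(pb_eq pP XP xX) -(pb_eq pP YP yY) /=; apply: connect_red => //.
  by rewrite -(root_connect (@link_sym i)) -/(rep i x) -/(rep i y) ex ey.
apply: (@leq_trans (#|K| * (t + t))); last by rewrite leq_mul2r cK orbT.
apply: card_bigcup_le => X _; apply: leq_trans (leq_card_setU _ _) _.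
by apply: leq_add; [apply: card_small | apply: card_complete].
Qed.

End WidthsFromContractions.

(** * Explicit bounds and the common bounding function *)

Lemma pathwidth_le_total_twinwidth (G : sgraph) t : 0 < t ->
  ~ subgraph (complete_bipartite t t) G ->
  pathwidth G <= 2 * t + total_twinwidth G * (t + total_twinwidth G + t).
Proof.
move=> t0 Kfree; case: (ltnP 1 #|G|) => [G1|G1].
  have [P [psP redk]] := sequence_width_attained (fun P => #|@red_edges G P|).
  exact: (@pathwidth_le_total G t P t0 Kfree psP _ G1 redk).
apply: leq_trans (leq0n _); apply: (pathwidth_le (trivial_decomposition G)) => _.
by rewrite cardsT.
Qed.

Lemma treewidth_le_component_twinwidth (G : sgraph) t : 0 < t ->
  ~ subgraph (complete_bipartite t t) G ->
  treewidth G <= 2 * t + component_twinwidth G * (t + t).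
Proof.
move=> t0 Kfree; case: (posnP #|G|) => [G0|G1].
  apply: leq_trans (leq0n _).
  apply: (treewidth_le is_tree_path_graph0 (trivial_decomposition G)) => _.
  by rewrite cardsT G0.
have [P [psP redk]] := sequence_width_attained (@max_red_component G).
exact: (@treewidth_le_component G t P t0 Kfree psP _ G1 redk).
Qed.

Theorem theorem3p3 (t : nat) (t_gt0 : 0 < t) :
  exists f : nat -> nat, forall G : sgraph,
    ~ subgraph (complete_bipartite t t) G ->
    [/\ treewidth G <= f (component_twinwidth G),
        component_twinwidth G <= f (treewidth G),
        pathwidth G <= f (total_twinwidth G)
      & total_twinwidth G <= f (pathwidth G)].
Proof.
(* The sum of the four bounds dominates each of them. *)
exists (fun k => (2 * t + k * (t + t)) + (2 + 2 * 2 ^ k.+2) +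
                 (2 * t + k * (t + k + t)) + k.+3) => G Kfree; split.
- apply: leq_trans (treewidth_le_component_twinwidth t_gt0 Kfree) _.
  exact: leq_trans (leq_addr _ _) (leq_trans (leq_addr _ _) (leq_addr _ _)).
- apply: leq_trans (component_twinwidth_le_treewidth G) _.
  exact: leq_trans (leq_addl _ _) (leq_trans (leq_addr _ _) (leq_addr _ _)).
- apply: leq_trans (pathwidth_le_total_twinwidth t_gt0 Kfree) _.
  exact: leq_trans (leq_addl _ _) (leq_addr _ _).
- exact: leq_trans (total_twinwidth_le_pathwidth G) (leq_addl _ _).
Qed.
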